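(* Let $\Delta$ be a negative integer with $\Delta\equiv 0,1 \pmod 4$, let $\tau\in\mathcal{F}$ and $\varepsilon\in(0,1/2)$. Then $$\mathcal{C}_\varepsilon(\tau,\Delta)\le F\left(\frac{48+16\sqrt{3}}{3}\,\frac{\sigma_1(\tilde f)}{\tilde f}\,|\Delta|^{1/2}\varepsilon^2+\frac{12+4\sqrt{3}}{3}|\Delta|^{1/2}\varepsilon+\frac{8|\Delta|^{1/4}}{(\sqrt3-1)^{1/2}}\,\sigma_0(\tilde f)\,\varepsilon+2\right),$$ where $F=F(\Delta)=\max\{2^{\omega(a)}: a \text{ a positive integer},\ a\le|\Delta|^{1/2}\}$.
   Context: $\mathcal{F}$ is the standard fundamental domain for $\mathrm{SL}_2(\mathbb{Z})$ in the upper half plane $\mathbb{H}$: the open hyperbolic triangle with vertices $\zeta_3=e^{2\pi i/3}$, $\zeta_6=e^{\pi i/3}$ and $i\infty$, together with the geodesics $[i,\zeta_6]$ and $[\zeta_6,i\infty)$. The discriminant of an imaginary quadratic number $z\in\mathbb{H}$ is $b^2-4ac$ where $ax^2+bx+c\in\mathbb{Z}[x]$ is its primitive minimal polynomial. For $\tau\in\mathcal{F}$ and $\varepsilon\in(0,1/2)$, $S_\varepsilon(\tau,\Delta)=\{z\in\mathbb{H}: z \text{ imaginary quadratic of discriminant } \Delta,\ |z-\tau|<\varepsilon\}$ and $\mathcal{C}_\varepsilon(\tau,\Delta)=\#S_\varepsilon(\tau,\Delta)$. Write $\Delta=f^2D$ with $D$ the discriminant of $\mathbb{Q}(\sqrt\Delta)$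 and $f$ the conductor; the modified conductor is $\tilde f=f$ if $D\equiv1\pmod4$ and $\tilde f=2f$ if $D\equiv 0\pmod 4$. For a positive integer $n$: $\omega(n)$ is the number of distinct prime divisors, $\sigma_0(n)$ the number of divisors, $\sigma_1(n)$ the sum of divisors. *)

(* Defs.v *)
From HB Require Import structures.
From mathcomp Require Import all_boot all_order all_algebra.
From mathcomp Require Import finmap.
From mathcomp Require Import complex.
From mathcomp Require Import classical_sets functions cardinality reals exp.

Set Implicit Arguments.
Unset Strict Implicit.
Unset Printing Implicit Defensive.

Import Order.TTheory GRing.Theory Num.Theory.
Local Open Scope classical_set_scope.
Local Open Scope ring_scope.
Local Open Scope complex_scope.

(* The order on R[i] is the partial one in which x <= y iff y - x is a
   nonnegative real, and `|z| is the (real) modulus seen in R[i]; hence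
   [`|z| < r%:C] is the usual comparison of the modulus with the real r. *)

Definition upper_half_plane (R : realType) : set R[i] :=
  [set z | 0 < complex.Im z].

(* The sides of the triangle (zeta_3, zeta_6, i oo) are carried by
   Re z = -1/2, Re z = 1/2 and |z| = 1. *)
Definition open_triangle (R : realType) : set R[i] :=
  [set z | [/\ 0 < complex.Im z, 1 < `|z|,
               - 2^-1 < complex.Re z & complex.Re z < 2^-1]].

Definition geodesic_i_zeta6 (R : realType) : set R[i] :=
  [set z | [/\ 0 < complex.Im z, `|z| = 1,
               0 <= complex.Re z & complex.Re z <= 2^-1]].

Definition geodesic_zeta6_ioo (R : realType) : set R[i] :=
  [set z | complex.Re z = 2^-1 /\ Num.sqrt 3 / 2 <= complex.Im z].

Definition fundamental_domain (R : realType) : set R[i] :=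
  @open_triangle R `|` @geodesic_i_zeta6 R `|` @geodesic_zeta6_ioo R.

(* [zcontents p] is the gcd of the coefficients with the sign of the leading
   coefficient, so [zcontents p = 1] says that p is primitive with positive
   leading coefficient. *)
Definition primitive_minpoly (R : realType) (z : R[i]) (p : {poly int}) : Prop :=
  [/\ zcontents p = 1,
      irreducible_poly (map_poly (intr : int -> rat) p)
    & root (map_poly (intr : int -> R[i]) p) z].

Definition imaginary_quadratic_of_disc (R : realType) (Delta : int) (z : R[i])
    : Prop :=
  complex.Im z != 0 /\
  exists p : {poly int},
    [/\ primitive_minpoly z p, size p = 3%N
      & p`_1 ^+ 2 - 4 * p`_2 * p`_0 = Delta].

Definition S_eps (R : realType) (eps : R) (tau : R[i]) (Delta : int) : set R[i] :=
  [set z | [/\ @upper_half_plane R z, imaginary_quadratic_of_disc Delta z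
             & `|z - tau| < eps%:C]].

(* The cardinal of S_eps; [fset_set] is only meaningful on finite sets. *)
Definition C_eps (R : realType) (eps : R) (tau : R[i]) (Delta : int) : nat :=
  #|` fset_set (S_eps eps tau Delta)|%fset.

Definition quadratic_field (R : realType) (Delta : int) : set R[i] :=
  [set z | exists x y : rat, z = ratr x + ratr y * sqrtC (Delta%:~R : R[i])].

Definition integers_of_quadratic_field (R : realType) (Delta : int) : set R[i] :=
  [set z | quadratic_field Delta z /\ integralOver (intr : int -> R[i]) z].

Definition integral_basis (R : realType) (Delta : int) (w1 w2 : R[i]) : Prop :=
  [/\ integers_of_quadratic_field Delta w1,
      integers_of_quadratic_field Delta w2
    & forall z : R[i], integers_of_quadratic_field Delta z ->
        exists! mn : int * int, z = mn.1%:~R * w1 + mn.2%:~R * w2].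

(* For Delta < 0 the two embeddings of Q(sqrt Delta) into the complex numbers
   are the inclusion and complex conjugation, so the field discriminant is the
   square of the determinant of the matrix with rows (w1, w2), (w1^*, w2^* ). *)
Definition quadratic_field_disc (R : realType) (Delta D : int) : Prop :=
  exists w1 w2 : R[i],
    integral_basis Delta w1 w2 /\
    (D%:~R : R[i]) = (w1 * Num.conj w2 - w2 * Num.conj w1) ^+ 2.

(* D is 0 or 1 modulo 4, being a field discriminant. *)
Definition modified_conductor (D : int) (f : nat) : nat :=
  if (D == 1 %[mod 4])%Z then f else (2 * f)%N.

Definition omega (n : nat) : nat := size (primes n).

Definition sigma0 (n : nat) : nat := size (divisors n).

Definition sigma1 (n : nat) : nat := (\sum_(d <- divisors n) d)%N.

(* The condition a <= |Delta|^(1/2) already forces a <= |Delta|, so the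
   explicit range only serves to make the maximum finite. *)
Definition F_max (R : realType) (Delta : int) : nat :=
  (\max_(1 <= a < `|Delta|.+1 |
     (a%:R <= (`|Delta|%:~R : R) `^ 2^-1)%R) 2 ^ omega a)%N.

(* Main.v *)
Require Import Defs.
From HB Require Import structures.
From mathcomp Require Import all_boot all_order all_algebra.
From mathcomp Require Import finmap.
From mathcomp Require Import complex.
From mathcomp Require Import classical_sets functions cardinality reals exp.
From mathcomp Require Import boolp.
From mathcomp Require Import zify ring lra.

Set Implicit Arguments.
Unset Strict Implicit.
Unset Printing Implicit Defensive.

Import Order.TTheory GRing.Theory Num.Theory.
Local Open Scope classical_set_scope.
Local Open Scope ring_scope.
Local Open Scope complex_scope.

(* A point z of S_eps is determined by the form (a, b, c) with
   2 a z = - b + i |Delta|^(1/2).  Since Im tau >= sqrt 3 / 2 and eps < 1/2, its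
   imaginary part confines a to an interval of length at most
   2 |Delta|^(1/2) eps with upper end at most |Delta|^(1/2) / (sqrt 3 - 1), and
   then its real part confines b to an interval of length 4 a eps.  The solutions
   of b^2 = Delta (mod 4 a) lie in at most 2^omega(a) classes modulo a / g_a, where
   g_a is the largest g with g^2 dividing both a and Delta; so each a contributes
   at most 2^omega(a) (4 eps g_a + 1) points.  Removing one prime from a shows
   2^omega(a) <= 2 F, even though a may exceed |Delta|^(1/2).  Finally Delta is
   ft^2 times a squarefree number, ft being the modified conductor, so g_a divides
   ft, and the sum of the g_a is at most the sum over d | ft of d times the number
   of multiples of d^2 among the a's. *)

(** * Square divisors of natural numbers *)

Section SquareDivisors.

Local Open Scope nat_scope.

(** The d with d^2 | n are closed under lcm, because valuations of an lcm are maxima; hence the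
    largest of them is a multiple of all the others. *)
Lemma exists_max_square_divisor (n : nat) : 0 < n ->
  exists2 g, g ^ 2 %| n & forall e, e ^ 2 %| n -> e %| g.
Proof.
move=> n_gt0; have ex1 : exists d, d ^ 2 %| n by exists 1; rewrite dvd1n.
have bound d : d ^ 2 %| n -> d <= n.
  by move=> /(dvdn_leq n_gt0); apply: leq_trans; rewrite expnS expn1; nia.
case: (ex_maxnP ex1 bound) => g g2n gmax; exists g => // e e2n.
have g_gt0 : 0 < g by case: (posnP g) g2n => // ->; rewrite dvd0n; lia.
have e_gt0 : 0 < e by case: (posnP e) e2n => // ->; rewrite dvd0n; lia.
have l_gt0 : 0 < lcmn g e by rewrite lcmn_gt0 g_gt0.
suff l2n : lcmn g e ^ 2 %| n.
  have gl := dvdn_lcml g e; have := gmax _ l2n => lg.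
  suff -> : g = lcmn g e by apply: dvdn_lcmr.
  by apply/eqP; rewrite eqn_leq lg (dvdn_leq l_gt0 gl).
apply/dvdn_partP => [|p]; first by rewrite expn_gt0 l_gt0.
rewrite mem_primes => /and3P [p_pr _ _].
rewrite p_part pfactor_dvdn // lognX logn_lcm //.
have := dvdn_leq_log p n_gt0 g2n; have := dvdn_leq_log p n_gt0 e2n.
by rewrite !lognX; lia.
Qed.

(** At each prime, 2 v(d) <= 2 v(m) + 1, and parity removes the 1. *)
Lemma sqr_dvdn_sqrM_squarefree (d m s : nat) : 0 < m ->
    (forall p, prime p -> ~~ (p ^ 2 %| s)) ->
  d ^ 2 %| m ^ 2 * s -> d %| m.
Proof.
move=> m_gt0 sqf_s dm.
have s_gt0 : 0 < s.
  by case: (posnP s) sqf_s => // -> /(_ 2 isT); rewrite dvdn0.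
have d_gt0 : 0 < d.
  by case: (posnP d) dm => // ->; rewrite dvd0n muln_eq0 expn_eq0; lia.
apply/dvdn_partP => // p; rewrite mem_primes => /and3P [p_pr _ _].
rewrite p_part pfactor_dvdn //.
have m2_gt0 : 0 < m ^ 2 by rewrite expn_gt0 m_gt0.
have ms_gt0 : 0 < m ^ 2 * s by rewrite muln_gt0 m2_gt0.
have := dvdn_leq_log p ms_gt0 dm; rewrite lognM // !lognX.
by have := sqf_s p p_pr; rewrite pfactor_dvdn //; lia.
Qed.

End SquareDivisors.

(** * Solutions of b^2 = Delta modulo 4 a *)

(* If p^m divides both x and x + b, then p^m divides b, hence p^(2 m) divides
   Delta as long as it divides a. *)
Lemma pfactor_dvdz_mul_add (a g p : nat) (Delta b x : int) :
    prime p -> (0 < a)%N -> (0 < g)%N ->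
    (forall e : nat, (e ^ 2 %| a)%N -> (e%:Z ^+ 2 %| Delta)%Z -> (e %| g)%N) ->
    (a%:Z %| b ^+ 2 - Delta)%Z -> (a%:Z %| x * (x + b))%Z ->
  let q : nat := (p ^ (logn p a - logn p g))%N in
  (q%:Z %| x)%Z || (q%:Z %| x + b)%Z.
Proof.
move=> p_pr a_gt0 g_gt0 gmax ab axb /=.
set k := logn p a; set e := logn p g.
have [->|x0] := eqVneq x 0; first by rewrite dvdz0.
have [->|y0] := eqVneq (x + b) 0; first by rewrite dvdz0 orbT.
rewrite !dvdzE /= !pfactor_dvdn ?absz_gt0 //.
set i := logn p `|x|; set j := logn p `|x + b|.
have kij : (k <= i + j)%N.
  rewrite -lognM ?absz_gt0 // -abszM.
  by apply: dvdn_leq_log; rewrite ?absz_gt0 ?mulf_neq0.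
(* p^n divides x and x + b, hence b, while p^(2 n) divides a; so p^(2 n) divides Delta and the
   maximality of g gives n <= e. With k <= i + j this forces i or j to be at least k - e, whichever
   of the three terms is the minimum. *)
pose n := minn (minn i j) (k %/ 2).
have pka : ((p ^ k)%N%:Z %| a%:Z)%Z by rewrite dvdzE /= pfactor_dvdnn.
have p2nk : ((p ^ n)%N%:Z ^+ 2 %| (p ^ k)%N%:Z)%Z.
  by rewrite dvdzE abszX /= -expnM dvdn_exp2l // /n; clear; lia.
have pnb : ((p ^ n)%N%:Z %| b)%Z.
  have ni : (n <= i)%N by rewrite /n; clear; lia.
  have nj : (n <= j)%N by rewrite /n; clear; lia.
  have pnx : ((p ^ n)%N%:Z %| x)%Z by rewrite dvdzE /= pfactor_dvdn ?absz_gt0.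
  rewrite -(rpredDl b pnx) dvdzE /= pfactor_dvdn ?absz_gt0 //.
suff : (n <= e)%N by rewrite /n; move: kij; clear; lia.
rewrite -pfactor_dvdn //; apply: gmax.
  by have := dvdz_trans p2nk pka; rewrite dvdzE abszX.
have -> : Delta = b ^+ 2 - (b ^+ 2 - Delta) by ring.
apply: rpredB; first by rewrite dvdz_exp2r.
exact: dvdz_trans (dvdz_trans p2nk pka) ab.
Qed.

(** The squares of b and b0 agree modulo 4, so b - b0 is even, and b^2 - b0^2 = 4 x (x + b0) for b =
    b0 + 2 x. *)
Lemma sqr_congruent_half (a : nat) (Delta b b0 : int) :
    (4 * a%:Z %| b ^+ 2 - Delta)%Z -> (4 * a%:Z %| b0 ^+ 2 - Delta)%Z ->
  exists2 x, b = b0 + 2 * x & (a%:Z %| x * (x + b0))%Z.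
Proof.
move=> /dvdzP [c cE] /dvdzP [c0 c0E].
pose x := ((b - b0) %/ 2)%Z.
have bE : b - b0 = 2 * x + ((b - b0) %% 2)%Z by rewrite mulrC -divz_eq.
have := modz_ge0 (b - b0) (isT : (2 : int) != 0).
have := ltz_mod (b - b0) (isT : (2 : int) != 0).
move: bE; set e := (_ %% _)%Z; rewrite (_ : `|2| = 2) // => bE e_lt e_ge.
have /orP [/eqP e0|/eqP e1] : (e == 0) || (e == 1) by lia.
  exists x; first by lia.
  apply/dvdzP; exists (c - c0); apply: (mulfI (isT : (4 : int) != 0)).
  have -> : 4 * (x * (x + b0)) = (b0 + 2 * x) ^+ 2 - b0 ^+ 2 by ring.
  have <- : b = b0 + 2 * x by lia.
  have -> : 4 * ((c - c0) * a%:Z) = c * (4 * a%:Z) - c0 * (4 * a%:Z) by ring.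
  by rewrite -cE -c0E; ring.
have : b ^+ 2 - b0 ^+ 2 = 4 * (a%:Z * (c - c0)).
  have -> : 4 * (a%:Z * (c - c0)) = c * (4 * a%:Z) - c0 * (4 * a%:Z) by ring.
  by rewrite -cE -c0E; ring.
have -> : b = b0 + (2 * x + 1) by lia.
have -> : (b0 + (2 * x + 1)) ^+ 2 - b0 ^+ 2
  = 2 * (2 * (x * x) + 2 * x + b0 * (2 * x + 1)) + 1 by ring.
clear; set u := _ + _ * _; set v := _ * (c - c0); lia.
Qed.

Section QuadraticCongruence.

Variables (a g : nat) (Delta : int).
Hypotheses (a_gt0 : (0 < a)%N) (g_dvd : (g %| a)%N).
Hypothesis g_max :
  forall e : nat, (e ^ 2 %| a)%N -> (e%:Z ^+ 2 %| Delta)%Z -> (e %| g)%N.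

(* A solution b is determined modulo a / g by the set of primes p | a for which
   it agrees with a fixed solution b0 (rather than with - b0) at p. *)
Lemma sqr_congruence_classes (b0 : int) :
    (4 * a%:Z %| b0 ^+ 2 - Delta)%Z ->
  exists h : int -> (omega a).-tuple bool,
    forall b c, (4 * a%:Z %| b ^+ 2 - Delta)%Z ->
      (4 * a%:Z %| c ^+ 2 - Delta)%Z -> h b = h c -> ((a %/ g)%N%:Z %| b - c)%Z.
Proof.
move=> b0P; have g_gt0 : (0 < g)%N := dvdn_gt0 a_gt0 g_dvd.
pose q p := (p ^ (logn p a - logn p g))%N.
(* For each prime p of a, one bit records whether [q p] divides x = (b - b0) / 2; if not, it divides
   x + b0 = (b + b0) / 2. *)
exists (fun b => map_tuple (fun p => ((q p)%:Z %| ((b - b0) %/ 2)%Z)%Z)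
                           (in_tuple (primes a))).
move=> b c bP cP.
have [x bE xP] := sqr_congruent_half bP b0P.
have [y cE yP] := sqr_congruent_half cP b0P.
have half z : ((b0 + 2 * z - b0) %/ 2)%Z = z by rewrite addrC addKr mulKz.
move=> /(congr1 val) /= /eq_in_map heq.
have -> : b - c = 2 * (x - y) by rewrite bE cE; ring.
apply: dvdz_mull; rewrite dvdzE /=.
have ag_gt0 : (0 < a %/ g)%N by rewrite divn_gt0 // dvdn_leq.
apply/dvdn_partP => // p.
rewrite mem_primes => /and3P [p_pr _ p_dvd].
have pa : p \in primes a.
  by rewrite mem_primes p_pr a_gt0 (dvdn_trans p_dvd) ?dvdn_div.
rewrite p_part logn_div // -[(_ %| _)%N]/((q p)%:Z %| x - y)%Z.
have ab0 : (a%:Z %| b0 ^+ 2 - Delta)%Z by apply: dvdz_trans b0P; apply: dvdz_mull.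
have := heq p pa; rewrite bE cE !half.
have := pfactor_dvdz_mul_add p_pr a_gt0 g_gt0 g_max ab0 xP.
have := pfactor_dvdz_mul_add p_pr a_gt0 g_gt0 g_max ab0 yP.
rewrite /= -/(q p).
case: (boolP (_ %| x)%Z) => [px _ _ /esym py|_ /= + pxb /esym npy].
  by apply: rpredB; rewrite ?px ?py.
rewrite npy /= => pyb.
have -> : x - y = (x + b0) - (y + b0) by ring.
exact: rpredB.
Qed.

End QuadraticCongruence.

(** * Counting solutions in an interval *)

(** Once sorted, consecutive entries differ by at least M, so (size - 1) M is at most the last entry
    minus the first. *)
Lemma size_congruent_in_interval (R : realFieldType) (s : seq int) (M : nat)
    (l u : R) :
    (0 < M)%N -> l <= u -> uniq s ->
    {in s &, forall x y, (M%:Z %| x - y)%Z} ->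
    {in s, forall x : int, l < x%:~R < u} ->
  (size s)%:R <= (u - l) / M%:R + 1.
Proof.
move=> M_gt0 lu s_uniq s_cong s_in.
have gap x t : path (fun x y : int => x + M%:Z <= y) x t ->
    (size t)%:Z * M%:Z <= last x t - x.
  elim: t x => [|y t IH] x /=; first by lia.
  by move=> /andP [xy /IH]; rewrite -add1n PoszD mulrDl mul1r; lia.
have M0 : 0 < M%:R :> R by rewrite ltr0n.
have perm_s : perm_eq (sort <=%O s) s by rewrite perm_sort.
have lt_s : sorted <%O (sort <=%O s).
  by rewrite lt_sorted_uniq_le sort_uniq s_uniq sort_sorted //; exact: le_total.
have gap_s : sorted (fun x y : int => x + M%:Z <= y) (sort <=%O s).
  apply: (@sub_in_sorted _ (mem s) <%O) lt_s; last first.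
    by apply/allP => x; rewrite mem_sort.
  move=> x y xs ys xy; have /dvdzP [k kE] := s_cong y x ys xs.
  have : 0 < k * M%:Z by rewrite -kE subr_gt0.
  rewrite pmulr_lgt0 ?ltz_nat // => k_gt0.
  by have : M%:Z <= k * M%:Z; [nia|lia].
rewrite -(perm_size perm_s); have mem_ss := perm_mem perm_s.
case: (sort _ _) gap_s mem_ss => [|x t] /= gap_s mem_s.
  by rewrite addr_ge0 // divr_ge0 ?subr_ge0 // ltW.
rewrite -natr1 lerD2r ler_pdivlMr //.
have := gap _ _ gap_s; rewrite -(ler_int R) rmorphM rmorphB /= !pmulrn => /le_trans->//.
have /andP [lx _] : l < x%:~R < u by apply: s_in; rewrite -mem_s mem_head.
have /andP [_ ux] : l < (last x t)%:~R < u by apply: s_in; rewrite -mem_s mem_last.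
by rewrite lerB // ltW.
Qed.

Lemma size_le_card_fibers (R : numDomainType) (I : eqType) (T : finType)
    (h : I -> T) (s : seq I) (c : R) :
    (forall v, (size [seq x <- s | h x == v])%:R <= c) ->
  (size s)%:R <= #|T|%:R * c.
Proof.
move=> hc; have -> : size s = (\sum_(v : T) size [seq x <- s | h x == v])%N.
  elim: s {hc} => [|x s IH] /=; first by rewrite big1.
  rewrite (bigD1 (h x)) //= eqxx /= IH (bigD1 (h x)) //= addSn; congr (_ + _).+1.
  by apply: eq_bigr => v; rewrite eq_sym => /negbTE ->.
rewrite natr_sum mulr_natl -sumr_const; exact: ler_sum.
Qed.

Lemma size_sqr_congruence_in_interval (R : realFieldType) (a g : nat)
    (Delta : int) (s : seq int) (l u : R) :
    (0 < a)%N -> (g %| a)%N ->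
    (forall e : nat, (e ^ 2 %| a)%N -> (e%:Z ^+ 2 %| Delta)%Z -> (e %| g)%N) ->
    l <= u -> uniq s ->
    {in s, forall b, (4 * a%:Z %| b ^+ 2 - Delta)%Z} ->
    {in s, forall x : int, l < x%:~R < u} ->
  (size s)%:R <= (2 ^ omega a)%:R * ((u - l) / a%:R * g%:R + 1).
Proof.
move=> a_gt0 g_dvd g_max lu s_uniq s_sol s_in.
have g_gt0 : (0 < g)%N := dvdn_gt0 a_gt0 g_dvd.
(* The classes are described relative to a known solution b0, so the empty list is treated apart. *)
case: s s_uniq s_sol s_in => [|b0 s'] s_uniq s_sol s_in.
  by rewrite mulr_ge0 // addr_ge0 // mulr_ge0 // divr_ge0 ?subr_ge0.
move: (b0 :: s') (mem_head b0 s') s_uniq s_sol s_in => s b0s s_uniq s_sol s_in.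
have [h hP] := sqr_congruence_classes a_gt0 g_dvd g_max (s_sol _ b0s).
have -> : (2 ^ omega a)%N = #|{: (omega a).-tuple bool}|.
  by rewrite card_tuple card_bool.
apply: (size_le_card_fibers (h := h)) => v.
have -> : (u - l) / a%:R * g%:R = (u - l) / (a %/ g)%:R.
  rewrite -{1}(divnK g_dvd) natrM invfM mulrA mulfVK //.
  by rewrite pnatr_eq0 -lt0n.
apply: size_congruent_in_interval => //.
- by rewrite divn_gt0 // dvdn_leq.
- exact: filter_uniq.
- move=> x y; rewrite !mem_filter => /andP [/eqP hx xs] /andP [/eqP hy ys].
  by apply: hP; rewrite ?s_sol // hx hy.
- by move=> x; rewrite mem_filter => /andP [_ /s_in].
Qed.

(** * Discriminants of quadratic fields *)

Section QuadraticFieldDiscriminant.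

Variable C : numClosedFieldType.
Implicit Types (z w : C) (Delta D : int).

(** By Gauss's lemma, X - t is proportional to an integral factor p1 of a monic p; the leading
    coefficients of p1 and of its cofactor r multiply to 1, so X - t is itself integral. *)
Lemma integralOver_rat_int (t : rat) :
  integralOver (intr : int -> C) (ratr t) -> exists n : int, t = n%:~R.
Proof.
case=> p p_monic pt.
have : root (map_poly (intr : int -> rat) p) t.
  rewrite -(fmorph_root (@ratr C)) -map_poly_comp.
  by rewrite (eq_map_poly (g := intr)) // => n /=; rewrite ratr_int.
rewrite root_factor_theorem => /dvdpP_rat_int [p1 [a a0 Xt] [r pE]].
have lead1 : lead_coef p1 * lead_coef r = 1.
  by rewrite -lead_coefM -pE (monicP p_monic).
have lead_a : 1 = a * (lead_coef p1)%:~R.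
  rewrite -[LHS](lead_coefXsubC t) Xt lead_coefZ lead_coef_map_inj //.
  exact: intr_inj.
have aE : a = (lead_coef r)%:~R.
  apply: (@mulIf _ (lead_coef p1)%:~R).
    by apply: contra_eqN lead1; rewrite intr_eq0 => /eqP ->; rewrite mul0r.
  by rewrite -lead_a -intrM mulrC lead1.
exists (- (lead_coef r * p1`_0)).
have := congr1 (fun q : {poly rat} => q`_0) Xt.
rewrite coefB coefX coefC coefZ coef_map /= aE sub0r rmorphN rmorphM /= => <-.
by rewrite opprK.
Qed.

Lemma integralOver_int_conj z :
  integralOver (intr : int -> C) z ->
  integralOver (intr : int -> C) (Num.conj z).
Proof.
case=> p p_monic pz; exists p => //.
rewrite -(fmorph_root Num.conj) -map_poly_comp in pz.
by rewrite -(eq_map_poly (f := Num.conj \o intr)) // => n /=; rewrite rmorph_int.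
Qed.

Lemma integralOver_int_quadratic z (t n : int) :
  z ^+ 2 - t%:~R * z + n%:~R = 0 -> integralOver (intr : int -> C) z.
Proof.
move=> z0; exists (Poly [:: n; - t; 1]).
  by rewrite monicE lead_coefE (@PolyK _ 0).
rewrite /root map_Poly horner_Poly /=.
by apply/eqP; rewrite -[RHS]z0 rmorphN /=; ring.
Qed.

Lemma conj_sqrtC_neg Delta : Delta < 0 ->
  Num.conj (sqrtC (Delta%:~R : C)) = - sqrtC (Delta%:~R : C).
Proof.
move=> Delta_lt0; set s := sqrtC _.
have s2 : s ^+ 2 = Delta%:~R by rewrite sqrtCK.
have /eqP : Num.conj s ^+ 2 = s ^+ 2 by rewrite -rmorphXn /= s2 rmorph_int.
rewrite eqf_sqr => /orP [/eqP /CrealP|/eqP //].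
by rewrite realEsqr s2 ler0z leNgt Delta_lt0.
Qed.

(** The condition defining [quadratic_field], over any [numClosedFieldType] in place of [R[i]]. *)
Definition rational_in_sqrt Delta z :=
  exists x y : rat, z = ratr x + ratr y * sqrtC Delta%:~R.

(** The trace and the norm of w1 conj(w2) are rational, as their coordinates show, and integral over
    the integers. *)
Lemma integral_quadratic_pair_norm_trace Delta w1 w2 : Delta < 0 ->
    rational_in_sqrt Delta w1 -> integralOver (intr : int -> C) w1 ->
    rational_in_sqrt Delta w2 -> integralOver (intr : int -> C) w2 ->
  exists t n : int, w1 * Num.conj w2 + w2 * Num.conj w1 = t%:~R /\
    w1 * Num.conj w2 * (w2 * Num.conj w1) = n%:~R.
Proof.
move=> Delta_lt0 [x1 [y1 w1E]] w1_int [x2 [y2 w2E]] w2_int.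
have w1c_int := integralOver_int_conj w1_int.
have w2c_int := integralOver_int_conj w2_int.
set s := sqrtC _ in w1E w2E.
have s2 : s * s = ratr Delta%:~R by rewrite -expr2 sqrtCK ratr_int.
have w1c : Num.conj w1 = ratr x1 - ratr y1 * s.
  by rewrite w1E rmorphD fmorph_rat rmorphM fmorph_rat /= conj_sqrtC_neg // mulrN.
have w2c : Num.conj w2 = ratr x2 - ratr y2 * s.
  by rewrite w2E rmorphD fmorph_rat rmorphM fmorph_rat /= conj_sqrtC_neg // mulrN.
have [t tE] : exists t : int, 2 * (x1 * x2) - 2 * (y1 * y2 * Delta%:~R) = t%:~R.
  apply: integralOver_rat_int.
  suff <- : w1 * Num.conj w2 + w2 * Num.conj w1
      = ratr (2 * (x1 * x2) - 2 * (y1 * y2 * Delta%:~R)).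
    by apply: integral_add; apply: integral_mul.
  rewrite w1c w2c w1E w2E !(rmorphB, rmorphM) /= -s2 !rmorph_nat; ring.
have [n nE] : exists n : int,
    (x1 ^+ 2 - y1 ^+ 2 * Delta%:~R) * (x2 ^+ 2 - y2 ^+ 2 * Delta%:~R) = n%:~R.
  apply: integralOver_rat_int.
  suff <- : w1 * Num.conj w2 * (w2 * Num.conj w1)
      = ratr ((x1 ^+ 2 - y1 ^+ 2 * Delta%:~R) * (x2 ^+ 2 - y2 ^+ 2 * Delta%:~R)).
    by apply: integral_mul; apply: integral_mul.
  rewrite w1c w2c w1E w2E !(rmorphB, rmorphM, rmorphXn) /= -s2; ring.
exists t, n; split.
  rewrite -[RHS](ratr_int C) -tE w1c w2c w1E w2E !(rmorphB, rmorphM) /= -s2 !rmorph_nat; ring.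
rewrite -[RHS](ratr_int C) -nE w1c w2c w1E w2E !(rmorphB, rmorphM, rmorphXn) /= -s2; ring.
Qed.

(** Stickelberger's congruence: with t and n the trace and norm of w1 conj(w2), the discriminant is
    t^2 - 4 n. *)
Lemma integral_quadratic_pair_disc_mod4 Delta D w1 w2 : Delta < 0 ->
    rational_in_sqrt Delta w1 -> integralOver (intr : int -> C) w1 ->
    rational_in_sqrt Delta w2 -> integralOver (intr : int -> C) w2 ->
    D%:~R = (w1 * Num.conj w2 - w2 * Num.conj w1) ^+ 2 ->
  (D = 0 %[mod 4])%Z \/ (D = 1 %[mod 4])%Z.
Proof.
move=> Delta_lt0 w1_q w1_int w2_q w2_int DE.
have [t [n [tE nE]]] :=
  integral_quadratic_pair_norm_trace Delta_lt0 w1_q w1_int w2_q w2_int.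
have {}DE : D = t ^+ 2 - 4 * n.
  apply: (@intr_inj C); rewrite DE rmorphB rmorphXn rmorphM /= -tE -nE; ring.
have tE2 := divz_eq t 2.
have := modz_ge0 t (isT : (2 : int) != 0).
have := ltz_mod t (isT : (2 : int) != 0).
rewrite (_ : `|2| = 2) //.
move: tE2; set q := (_ %/ _)%Z; set r := (_ %% _)%Z => tE2 r_lt r_ge.
have /orP [/eqP r0|/eqP r1] : (r == 0) || (r == 1) by lia.
  left; rewrite DE tE2 r0.
  have -> : (q * 2 + 0) ^+ 2 - 4 * n = 0 + (q * q - n) * 4 by ring.
  by rewrite addrC modzMDl.
right; rewrite DE tE2 r1.
have -> : (q * 2 + 1) ^+ 2 - 4 * n = 1 + (q * q + q - n) * 4 by ring.
by rewrite addrC modzMDl.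
Qed.

(** The hypotheses make t the trace and n the norm of z, which is thus a root of X^2 - t X + n, of
    discriminant e. *)
Lemma rational_in_sqrt_trace_norm Delta (x y : rat) (t n e : int) :
    Delta < 0 -> 2 * x = t%:~R -> x ^+ 2 - y ^+ 2 * Delta%:~R = n%:~R ->
    4 * (y ^+ 2 * Delta%:~R) = e%:~R ->
  let z : C := ratr x + ratr y * sqrtC Delta%:~R in
  integralOver (intr : int -> C) z /\ (Num.conj z - z) ^+ 2 = e%:~R.
Proof.
move=> Delta_lt0 tE nE eE z.
have s2 : sqrtC Delta%:~R * sqrtC Delta%:~R = ratr Delta%:~R :> C.
  by rewrite -expr2 sqrtCK ratr_int.
have zc : Num.conj z = ratr x - ratr y * sqrtC Delta%:~R.
  by rewrite rmorphD fmorph_rat rmorphM fmorph_rat /= conj_sqrtC_neg // mulrN.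
split.
  apply: (@integralOver_int_quadratic _ t n).
  rewrite -(ratr_int C t) -(ratr_int C n) -tE -nE /z.
  rewrite !(rmorphB, rmorphM, rmorphXn) /= -s2 !rmorph_nat; ring.
rewrite zc -(ratr_int C e) -eE /z !(rmorphM, rmorphXn) /= -s2 !rmorph_nat; ring.
Qed.

(* The order Z + Z z has index |m1 * n2 - m2 * n1| in Z w1 + Z w2. *)
Lemma disc_index w1 w2 z (m1 n1 m2 n2 : int) :
    1 = m1%:~R * w1 + n1%:~R * w2 -> z = m2%:~R * w1 + n2%:~R * w2 ->
  (Num.conj z - z) ^+ 2 =
    (m1 * n2 - m2 * n1)%:~R ^+ 2 * (w1 * Num.conj w2 - w2 * Num.conj w1) ^+ 2.
Proof.
move=> E1 Ez.
have E1c : 1 = m1%:~R * Num.conj w1 + n1%:~R * Num.conj w2.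
  by have := congr1 Num.conj E1; rewrite rmorph1 rmorphD !rmorphM /= !rmorph_int.
have Ezc : Num.conj z = m2%:~R * Num.conj w1 + n2%:~R * Num.conj w2.
  by rewrite Ez rmorphD !rmorphM /= !rmorph_int.
have -> : Num.conj z - z = (m1%:~R * w1 + n1%:~R * w2) * Num.conj z
    - (m1%:~R * Num.conj w1 + n1%:~R * Num.conj w2) * z.
  by rewrite -E1 -E1c !mul1r.
rewrite Ezc Ez.
by rewrite rmorphB !rmorphM /=; ring.
Qed.

Lemma sqr_dvd_disc_contra (E k : int) (p : nat) : E != 0 -> prime p ->
  E = k ^+ 2 * (p%:Z ^+ 2 * E) -> False.
Proof.
move=> E0 p_pr; rewrite mulrA -[X in X = _]mul1r => /(mulIf E0) /esym kp.
have := congr1 absz kp; rewrite -exprMn abszX abszM /= -mulnn.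
by have := prime_gt1 p_pr; nia.
Qed.

End QuadraticFieldDiscriminant.

(** The cofactor s is |D| or |D / 4|. If p^2 divided it, some integer z of the field would have
    (conj z - z)^2 = D / p^2, whereas by [disc_index] this quantity is D times the square of an
    integer. *)
Lemma modified_conductor_squarefree (R : realType) (Delta D : int) (f : nat) :
    Delta < 0 -> quadratic_field_disc R Delta D ->
    (0 < f)%N -> Delta = f%:Z ^+ 2 * D ->
  exists2 s : nat, `|Delta|%N = (modified_conductor D f ^ 2 * s)%N &
    forall p, prime p -> ~~ (p ^ 2 %| s)%N.
Proof.
move=> Delta_lt0 [w1 [w2 [[[w1_q w1_int] [w2_q w2_int] basis] DE]]] f_gt0 Delta_fD.
have D_mod4 :=
  integral_quadratic_pair_disc_mod4 Delta_lt0 w1_q w1_int w2_q w2_int DE.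
have f0 : f%:~R != 0 :> rat by rewrite intr_eq0; lia.
have int1 : integers_of_quadratic_field Delta (1 : R[i]).
  split; last exact: integral1.
  by exists 1, 0; rewrite rmorph1 rmorph0 mul0r addr0.
have [[m1 n1] /= [E1 _]] := basis _ int1.
have index (z : R[i]) : integers_of_quadratic_field Delta z ->
    exists k : int, (Num.conj z - z) ^+ 2 = (k ^+ 2 * D)%:~R.
  move=> /basis [[m2 n2] /= [Ez _]]; exists (m1 * n2 - m2 * n1).
  by rewrite (disc_index E1 Ez) -DE rmorphM rmorphXn.
have key (x y : rat) (t n e : int) :
    2 * x = t%:~R -> x ^+ 2 - y ^+ 2 * Delta%:~R = n%:~R ->
    4 * (y ^+ 2 * Delta%:~R) = e%:~R -> exists k : int, e = k ^+ 2 * D.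
  move=> tE nE eE.
  have [z_int zE] := rational_in_sqrt_trace_norm R[i] Delta_lt0 tE nE eE.
  have [|k kE] := index (ratr x + ratr y * sqrtC Delta%:~R).
    by split=> //; exists x, y.
  by exists k; apply: (@intr_inj R[i]); rewrite -kE -zE.
have D0 : D != 0 by apply: contraTneq Delta_lt0 => D0; rewrite Delta_fD D0 mulr0.
rewrite /modified_conductor; case: eqP => D1.
  exists `|D|%N; first by rewrite Delta_fD abszM abszX.
  move=> p p_pr; apply/negP => p2D.
  have /dvdzP [E DE'] : (p%:Z ^+ 2 %| D)%Z by rewrite dvdzE abszX.
  have E0 : E != 0 by apply: contraNneq D0 => E0; rewrite DE' E0 mul0r.
  have p0 : p%:~R != 0 :> rat by rewrite intr_eq0; have := prime_gt0 p_pr; lia.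
  have DeltaQ : Delta%:~R = f%:~R ^+ 2 * (E%:~R * p%:~R ^+ 2) :> rat.
    by rewrite Delta_fD DE' !(rmorphM, rmorphXn).
  (* D is odd, so p is odd, p^2 = 1 modulo 4 and E = D modulo 4. *)
  have [j EE] : exists j, E = 1 + 4 * j.
    have DE4 := divz_eq D 4; rewrite D1 (_ : (1 %% 4)%Z = 1) // in DE4.
    move: DE4; set d := (_ %/ _)%Z => DE4; rewrite DE' in DE4.
    have pE := divn_eq p 2; have := ltn_pmod p (isT : (0 < 2)%N).
    move: pE; set i := (p %/ 2)%N; set r := (p %% 2)%N => pE r_lt.
    have /orP [/eqP r0|/eqP r1] : (r == 0%N) || (r == 1%N) by lia.
      move: DE4; rewrite pE r0 addn0 PoszM.
      have -> : E * (i%:Z * 2%:Z) ^+ 2 = 4 * (E * i%:Z * i%:Z) by ring.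
      by clear; set u := _ * _ * _; lia.
    exists (d - (E * i%:Z * i%:Z + E * i%:Z)).
    move: DE4; rewrite pE r1 PoszD PoszM.
    have -> : E * (i%:Z * 2%:Z + 1%:Z) ^+ 2
      = 4 * (E * i%:Z * i%:Z + E * i%:Z) + E by ring.
    by clear; set u := _ * _ + _ * _; lia.
  (* Up to the sign of the root this is z = (1 + sqrt E) / 2, since Delta = (f p)^2 E; its norm is
     (1 - E) / 4 = - j. *)
  have [] := key 2^-1 ((2 * f%:~R * p%:~R)^-1) 1 (- j) E.
  - by [].
  - by rewrite DeltaQ EE !(rmorphD, rmorphM, rmorphN) /=; field; rewrite f0 p0.
  - by rewrite DeltaQ; field; rewrite f0 p0.
  move=> k; rewrite DE' [E * _]mulrC => kE.
  exact: (sqr_dvd_disc_contra E0 p_pr kE).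
case: D_mod4 => // D4.
have /dvdzP [D' D'E] : (4 %| D)%Z by apply/dvdz_mod0P.
exists `|D'|%N.
  by rewrite Delta_fD D'E abszM abszX abszM /=; lia.
move=> p p_pr; apply/negP => p2D.
have /dvdzP [E DE'] : (p%:Z ^+ 2 %| D')%Z by rewrite dvdzE abszX.
have E0 : E != 0 by apply: contraNneq D0 => E0; rewrite D'E DE' E0 !mul0r.
have p0 : p%:~R != 0 :> rat by rewrite intr_eq0; have := prime_gt0 p_pr; lia.
have DeltaQ : Delta%:~R = f%:~R ^+ 2 * (E%:~R * p%:~R ^+ 2 * 4) :> rat.
  by rewrite Delta_fD D'E DE' !(rmorphM, rmorphXn).
(* Here Delta = (2 f p)^2 E, and z is a square root of E, with discriminant 4 E. *)
have [] := key 0 ((2 * f%:~R * p%:~R)^-1) 0 (- E) (4 * E).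
- by [].
- by rewrite DeltaQ rmorphN /=; field; rewrite f0 p0.
- by rewrite DeltaQ rmorphM /=; field; rewrite f0 p0.
move=> k; rewrite D'E DE' => kE.
apply: (@sqr_dvd_disc_contra E k p) => //.
by apply: (mulfI (isT : (4 : int) != 0)); rewrite kE; ring.
Qed.

(** * Divisor sums and the function omega *)

(** The map d -> n / d permutes the divisors of n. *)
Lemma sum_divisors_inv (R : numFieldType) (n : nat) : (0 < n)%N ->
  \sum_(d <- divisors n) d%:R^-1 = (sigma1 n)%:R / n%:R :> R.
Proof.
move=> n_gt0.
have divP d : d \in divisors n -> (n %/ d * d)%N = n.
  by rewrite -dvdn_divisors // => /divnK.
have perm_div : perm_eq [seq (n %/ d)%N | d <- divisors n] (divisors n).
  apply: uniq_perm; rewrite ?divisors_uniq //.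
    rewrite map_inj_in_uniq ?divisors_uniq // => d e /divP dE /divP eE de.
    by move: dE eE; rewrite -de; nia.
  move=> d; apply/mapP/idP => [[e e_n ->]|d_n].
    by rewrite -dvdn_divisors //; apply: dvdn_div; rewrite dvdn_divisors.
  exists (n %/ d)%N.
    by rewrite -dvdn_divisors //; apply: dvdn_div; rewrite dvdn_divisors.
  by have := divP _ d_n; rewrite -dvdn_divisors // in d_n; rewrite divnA // mulKn.
rewrite /sigma1 -(perm_big _ perm_div) big_map /= natr_sum mulr_suml.
rewrite big_seq [RHS]big_seq; apply: eq_bigr => d /divP dE.
have d_gt0 : (0 < d)%N by nia.
have nE : n%:R = (n %/ d)%:R * d%:R :> R by rewrite -natrM dE.
by rewrite nE invfM mulrCA divff ?mulr1 // pnatr_eq0 -lt0n.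
Qed.

Lemma omega_cofactor (a p : nat) : (0 < a)%N -> prime p -> (p %| a)%N ->
  omega a = (omega (a %/ p ^ logn p a)).+1.
Proof.
move=> a_gt0 p_pr p_a.
have q_dvd : (p ^ logn p a %| a)%N by apply: pfactor_dvdnn.
set b := (a %/ _)%N; have bE : (b * p ^ logn p a)%N = a by apply: divnK.
have b_gt0 : (0 < b)%N by move: a_gt0; rewrite -bE muln_gt0 => /andP [].
have pb : ~~ (p %| b)%N.
  rewrite -[p in (p %| _)%N]expn1 pfactor_dvdn // logn_div // pfactorK //.
  by rewrite subnn.
have : perm_eq (primes a) (p :: primes b).
  apply: uniq_perm; rewrite ?primes_uniq //=.
    by rewrite primes_uniq andbT mem_primes (negbTE pb) !andbF.
  move=> q; rewrite inE !mem_primes a_gt0 b_gt0 /=.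
  have [-> |qp] := eqVneq q p; first by rewrite p_pr p_a.
  case: (boolP (prime q)) => //= q_pr.
  rewrite -{1}bE Euclid_dvdM // Euclid_dvdX // (dvdn_prime2 q_pr p_pr).
  by rewrite (negbTE qp) orbF.
by rewrite /omega => /perm_size.
Qed.

(** Dividing a > 1 by the full power of its least prime at least halves it, which brings it below
    |Delta|^(1/2), and lowers omega by exactly one. *)
Lemma exp_omega_le_F_max (R : realType) (Delta : int) (a : nat) :
    Delta != 0 -> (0 < a)%N -> a%:R <= 2 * (`|Delta|%:~R : R) `^ 2^-1 ->
  (2 ^ omega a <= 2 * F_max R Delta)%N.
Proof.
move=> Delta0 a_gt0; rewrite powR12_sqrt ?ler0z // => aN.
have le_F b : (0 < b)%N -> b%:R <= Num.sqrt (`|Delta|%:~R : R) ->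
    (2 ^ omega b <= F_max R Delta)%N.
  move=> b_gt0 bN.
  apply: (@leq_bigmax_seq _ _ _ (fun b => 2 ^ omega b)%N); last first.
    by rewrite powR12_sqrt ?ler0z.
  have : b%:R ^+ 2 <= `|Delta|%:~R :> R.
    by rewrite -[leRHS]sqr_sqrtr ?ler0z // lerXn2r ?nnegrE ?sqrtr_ge0.
  rewrite -natrX -abszE -pmulrn ler_nat mem_index_iota; nia.
have F_gt0 : (1 <= F_max R Delta)%N.
  by apply: (le_F 1%N) => //; rewrite -[leLHS]sqrtr1 ler_sqrt ?ler1z ?ler0z //; lia.
have [a_le1|a_gt1] := leqP a 1.
  by rewrite (_ : a = 1%N) ?expn0; lia.
have p_pr := pdiv_prime a_gt1; have p_a := pdiv_dvd a.
rewrite (omega_cofactor a_gt0 p_pr p_a) expnS leq_mul2l /=.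
set p := pdiv a in p_pr p_a *.
have q_dvd : (p ^ logn p a %| a)%N by apply: pfactor_dvdnn.
have l_gt0 : (0 < logn p a)%N by rewrite logn_gt0 mem_primes p_pr a_gt0.
have q_ge2 : (2 <= p ^ logn p a)%N.
  apply: leq_trans (prime_gt1 p_pr) _.
  by rewrite -{1}[p]expn1 leq_exp2l ?prime_gt1.
have bE := divnK q_dvd; apply: le_F; first by nia.
rewrite -(@ler_pM2l R 2) //; apply: le_trans aN.
by rewrite -natrM ler_nat; nia.
Qed.

(** Bound [g a] by the sum of all d | n with d^2 | a and exchange the sums. Each d then contributes
    d times the number of multiples of d^2 between l and u, at most (u - l) / d + d. *)
Lemma sum_sqr_divisors_in_interval (R : rcfType) (n : nat) (g : nat -> nat)
    (s : seq nat) (l u : R) :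
    (0 < n)%N -> l <= u -> uniq s ->
    {in s, forall a, (0 < a)%N /\ l < a%:R < u} ->
    {in s, forall a, (g a %| n)%N /\ (g a ^ 2 %| a)%N} ->
  (\sum_(a <- s) g a)%:R
    <= (u - l) * ((sigma1 n)%:R / n%:R) + (sigma0 n)%:R * Num.sqrt u.
Proof.
move=> n_gt0 lu s_uniq s_in s_g.
have : (\sum_(a <- s) g a <=
    \sum_(d <- divisors n) \sum_(a <- s | d ^ 2 %| a) d)%N.
  rewrite (exchange_big_dep xpredT) //= big_seq [leqRHS]big_seq.
  apply: leq_sum => a /s_g [gn ga].
  rewrite -big_filter (big_rem (g a)) /= ?leq_addr //.
  by rewrite mem_filter ga -dvdn_divisors.
rewrite -(ler_nat R) => /le_trans; apply.
rewrite -sum_divisors_inv // mulr_sumr /sigma0 -sum1_size [in X in _ + X]natr_sum.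
rewrite mulr_suml -big_split natr_sum /= big_seq [leRHS]big_seq.
apply: ler_sum => d; rewrite -dvdn_divisors // mul1r => d_n.
have d_gt0 := dvdn_gt0 n_gt0 d_n.
have d0 : 0 < d%:R :> R by rewrite ltr0n.
rewrite -big_filter; set t := filter _ s.
have tP a : a \in t -> (d ^ 2 %| a)%N /\ a \in s.
  by rewrite mem_filter => /andP [].
have t_uniq : uniq t by apply: filter_uniq.
rewrite big_const_seq count_predT iter_addn_0 natrM.
(* Without multiples of d^2 the term vanishes; a multiple a0 < u forces d <= sqrt u, which bounds
   the extra d. *)
case: t tP t_uniq => [|a0 t'] tP t_uniq.
  by rewrite mulr0 addr_ge0 ?sqrtr_ge0 // mulr_ge0 ?subr_ge0 // invr_ge0 ltW.
have [d2a0 /s_in [a0_gt0 /andP [_ a0u]]] := tP a0 (mem_head _ _).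
have d_le : d%:R <= Num.sqrt u.
  rewrite -[leLHS]ger0_norm ?ler0n // -sqrtr_sqr; apply: ler_wsqrtr.
  apply/ltW; apply: le_lt_trans a0u.
  by rewrite -natrX ler_nat dvdn_leq.
move: (a0 :: t') tP t_uniq => t tP t_uniq.
have : (size t)%:R <= (u - l) / (d ^ 2)%:R + 1.
  rewrite -(size_map Posz); apply: size_congruent_in_interval => //.
  - by rewrite expn_gt0 d_gt0.
  - by rewrite map_inj_uniq // => x y [].
  - move=> _ _ /mapP [x /tP [dx _] ->] /mapP [y /tP [dy _] ->].
    by apply: rpredB; rewrite dvdzE.
  - by move=> _ /mapP [x /tP [_ /s_in [_ ?]] ->].
move=> /(ler_wpM2l (ltW d0)) /le_trans; apply.
rewrite mulrDr mulr1 natrX lerD //.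
by rewrite expr2 invfM mulrCA mulVKf ?gt_eqF.
Qed.

(** * Finiteness and the count of forms *)

(** An infinite set would contain a finite subset with more than B elements, so bounding
    duplicate-free lists settles finiteness and cardinality together. *)
Lemma finite_set_uniq_seq_bound (R : realType) (T : choiceType) (S : set T)
    (B : R) :
    (forall t : seq T, uniq t -> {in t, forall z, S z} -> (size t)%:R <= B) ->
  finite_set S /\ (#|` fset_set S|%fset)%:R <= B.
Proof.
move=> bound.
have S_fin : finite_set S.
  apply: contrapT => /(@infinite_set_fset _ _ (Num.truncn B).+1) [X XS].
  apply/negP; rewrite -ltnNge ltnS -ltnS.
  have : (#|` X|%fset)%:R <= B by apply: bound => [|z zX]; [exact: fset_uniq|exact: XS].
  by move=> /le_lt_trans /(_ (truncnS_gt B)); rewrite ltr_nat.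
split=> //; apply: bound => [|z]; first exact: fset_uniq.
by rewrite in_fset_set // inE.
Qed.

(** A pair q stands for the coefficients (a, b). Grouping by a gives at most G (w g_a + 1) pairs for
    each a; there are at most hi - lo + 1 values of a, and [sum_sqr_divisors_in_interval] bounds the
    sum of the g_a. *)
Lemma size_quadratic_forms (R : realType) (Delta : int) (n : nat)
    (s : seq (nat * int)) (G lo hi l w : R) :
    Delta != 0 -> (0 < n)%N ->
    (forall d : nat, (d%:Z ^+ 2 %| Delta)%Z -> (d %| n)%N) ->
    lo <= hi -> 0 <= w -> uniq s ->
    {in s, forall q, (0 < q.1)%N /\ (4 * q.1%:Z %| q.2 ^+ 2 - Delta)%Z} ->
    {in s, forall q, lo < q.1%:R < hi} ->
    {in s, forall q, l * q.1%:R < q.2%:~R < (l + w) * q.1%:R} ->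
    {in s, forall q, (2 ^ omega q.1)%:R <= G} -> 0 <= G ->
  (size s)%:R <= G * (w * ((hi - lo) * ((sigma1 n)%:R / n%:R)
                           + (sigma0 n)%:R * Num.sqrt hi) + (hi - lo) + 1).
Proof.
move=> Delta0 n_gt0 n_max lohi w_ge0 s_uniq s_sol s_lohi s_lw s_G G_ge0.
have gcd_gt0 a : (0 < gcdn a `|Delta|)%N by rewrite gcdn_gt0 absz_gt0 Delta0 orbT.
have ex_g a : exists d, (d ^ 2 %| gcdn a `|Delta|)%N /\
    forall e, (e ^ 2 %| gcdn a `|Delta|)%N -> (e %| d)%N.
  by have [d ? ?] := exists_max_square_divisor (gcd_gt0 a); exists d.
have [g gP] := boolp.choice ex_g.
pose As := undup (map fst s).
pose Bs a := [seq q.2 | q <- s & q.1 == a].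
have AsP a : a \in As -> exists b, (a, b) \in s.
  by rewrite mem_undup => /mapP [[a' b] /= ? ->]; exists b.
have BsP a b : b \in Bs a -> (a, b) \in s.
  by move=> /mapP [[a' b']]; rewrite mem_filter => /andP [/= /eqP -> ? ->].
have -> : size s = (\sum_(a <- As) size (Bs a))%N.
  rewrite -sum1_size.
  transitivity (\sum_(q <- s) \sum_(a <- As | q.1 == a) 1)%N.
    apply: eq_big_seq => q qs; rewrite -big_filter.
    rewrite (eq_filter (a2 := pred1 q.1)); last by move=> a /=; rewrite eq_sym.
    by rewrite filter_pred1_uniq ?undup_uniq ?big_seq1 // mem_undup map_f.
  rewrite (exchange_big_dep xpredT) //=; apply: eq_bigr => a _.
  by rewrite size_map size_filter -sum1_count.
have g2a a : (g a ^ 2 %| a)%N by have [/dvdn_trans->//] := gP a; exact: dvdn_gcdl.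
have Bs_le a : a \in As -> (size (Bs a))%:R <= G * (w * (g a)%:R + 1).
  move=> /AsP [b0 abs]; have [/= a_gt0 _] := s_sol _ abs.
  have a0 : 0 < a%:R :> R by rewrite ltr0n.
  have [_ gmax] := gP a.
  have /le_trans : (size (Bs a))%:R <=
      (2 ^ omega a)%:R * (((l + w) * a%:R - l * a%:R) / a%:R * (g a)%:R + 1).
    apply: (@size_sqr_congruence_in_interval R a (g a) Delta) => //.
    - by apply: dvdn_trans (g2a a); rewrite dvdn_exp.
    - move=> e ea eD; apply: gmax; rewrite dvdn_gcd ea.
      by move: eD; rewrite dvdzE abszX.
    - by rewrite ler_pM2r // lerDl.
    - rewrite map_inj_in_uniq ?filter_uniq // => -[a1 b1] [a2 b2].
      by rewrite !mem_filter /= => /andP [/eqP -> _] /andP [/eqP -> _] ->.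
    - by move=> b /BsP /s_sol [].
    - by move=> b /BsP /s_lw.
  apply; rewrite -mulrBl mulfK ?gt_eqF //.
  have -> : l + w - l = w by rewrite addrC addKr.
  apply: ler_wpM2r; first by rewrite addr_ge0 // mulr_ge0.
  exact: (s_G _ abs).
have As_uniq : uniq As by apply: undup_uniq.
have sumg : (\sum_(a <- As) g a)%:R
    <= (hi - lo) * ((sigma1 n)%:R / n%:R) + (sigma0 n)%:R * Num.sqrt hi.
  apply: sum_sqr_divisors_in_interval => // a aA.
    by have [b abs] := AsP a aA; have [] := s_sol _ abs; have := s_lohi _ abs.
  split=> //; apply: n_max; rewrite dvdzE abszX /=.
  by have [/dvdn_trans->//] := gP a; exact: dvdn_gcdr.
have sizeA : (size As)%:R <= hi - lo + 1.
  rewrite -(size_map Posz) -[X in X + 1]divr1.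
  apply: (@size_congruent_in_interval _ _ 1) => //.
  - by rewrite map_inj_uniq // => x y [].
  - by move=> _ /mapP [a /AsP [b /s_lohi ?] ->].
rewrite natr_sum.
apply: (@le_trans _ _ (\sum_(a <- As) G * (w * (g a)%:R + 1))).
  by rewrite big_seq [leRHS]big_seq; apply: ler_sum => a /Bs_le.
rewrite -mulr_sumr big_split /= -mulr_sumr -natr_sum.
rewrite big_const_seq count_predT iter_addr_0.
by apply: ler_wpM2l => //; rewrite -addrA lerD // ler_wpM2l.
Qed.

(** * Imaginary quadratic points and the fundamental domain *)

(** For z = x + i y the imaginary part of the quadratic equation gives b = - 2 a x; substituting c
    from the real part gives Delta = - (2 a y)^2. *)
Lemma imaginary_quadratic_form (R : realType) (Delta : int) (z : R[i]) :
    0 < complex.Im z -> imaginary_quadratic_of_disc Delta z ->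
  exists (a : nat) (b : int),
    [/\ (0 < a)%N, (4 * a%:Z %| b ^+ 2 - Delta)%Z,
        2 * a%:R * complex.Re z = - b%:~R
      & 2 * a%:R * complex.Im z = Num.sqrt (`|Delta|%:~R : R)].
Proof.
move=> Im_gt0 [_ [p [[p_prim _ pz] p_size disc]]].
have a_gt0 : 0 < p`_2.
  have -> : p`_2 = lead_coef p by rewrite lead_coefE p_size.
  by rewrite -sgz_gt0 -sgz_contents p_prim.
have {pz} : (p`_0)%:~R + (p`_1)%:~R * z + (p`_2)%:~R * z ^+ 2 = 0.
  move: pz; rewrite /root (@horner_coef_wide _ 3); last first.
    by rewrite -p_size size_poly.
  rewrite !big_ord_recl big_ord0 /= !coef_map /= => /eqP <-.
  by rewrite /bump /=; ring.
case: z Im_gt0 => x y /= y_gt0.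
set a := p`_2 in a_gt0 disc *; set b := p`_1 in disc *; set c := p`_0 in disc *.
have intC (k : int) : k%:~R = (k%:~R)%:C :> R[i] by rewrite rmorph_int.
rewrite !intC => /eqP; rewrite eq_complex /= => /andP [/eqP re /eqP im].
have {}re : c%:~R + b%:~R * x + a%:~R * (x ^+ 2 - y ^+ 2) = 0 :> R.
  by rewrite -re; ring.
have {}im : y * (b%:~R + 2 * (a%:~R * x)) = 0 :> R by rewrite -im; ring.
have {im} bE : b%:~R = - (2 * (a%:~R * x)) :> R.
  move/eqP: im; rewrite mulf_eq0 (gt_eqF y_gt0) /= => /eqP im.
  by apply/eqP; rewrite -subr_eq0 opprK im.
exists `|a|%N, b.
have aE : `|a|%N%:R = a%:~R :> R by rewrite pmulrn gtz0_abs.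
split; first by rewrite absz_gt0 gt_eqF.
- apply/dvdzP; exists c; rewrite -disc gtz0_abs //; ring.
- by rewrite aE bE; ring.
rewrite aE; have a0 : 0 < a%:~R :> R by rewrite ltr0z.
rewrite -[LHS]ger0_norm -?sqrtr_sqr; last by rewrite !mulr_ge0 ?ltW.
congr Num.sqrt.
have DeltaE : Delta%:~R = - (2 * a%:~R * y) ^+ 2 :> R.
  have -> : Delta%:~R = b%:~R ^+ 2 - 4 * a%:~R * c%:~R :> R.
    by rewrite -disc !(rmorphB, rmorphXn, rmorphM).
  have -> : c%:~R = - (b%:~R * x + a%:~R * (x ^+ 2 - y ^+ 2)) :> R.
    by apply/eqP; rewrite -subr_eq0 opprK addrA re.
  by rewrite bE; ring.
have Delta_le0 : Delta <= 0 by rewrite -(lerz0 R) DeltaE oppr_le0 sqr_ge0.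
by rewrite ler0_norm // mulrNz DeltaE opprK.
Qed.

Lemma normc_lt_Re_Im (R : realType) (z : R[i]) (e : R) :
  `|z| < e%:C -> `|complex.Re z| < e /\ `|complex.Im z| < e.
Proof.
rewrite normc_def ltcR => ze; rewrite -!sqrtr_sqr.
by split; apply: le_lt_trans ze; apply: ler_wsqrtr; rewrite ?lerDl ?lerDr sqr_ge0.
Qed.

(** From |z| >= 1 and |Re z| <= 1/2 follows (Im z)^2 >= 3/4; on the vertical side the bound is part
    of the definition. *)
Lemma fundamental_domain_Im (R : realType) (tau : R[i]) :
  @fundamental_domain R tau -> Num.sqrt 3 / 2 <= complex.Im tau.
Proof.
have bound (x y : R) : 0 < y -> 1 <= x ^+ 2 + y ^+ 2 -> `|x| <= 2^-1 ->
    Num.sqrt 3 / 2 <= y.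
  move=> y_gt0 xy x_le.
  have : x ^+ 2 <= 4^-1.
    rewrite -real_normK ?num_real // (_ : 4^-1 = 2^-1 ^+ 2); last by field.
    by rewrite lerXn2r ?nnegrE ?normr_ge0 ?invr_ge0 ?ler0n.
  move=> x2; have y2_ge0 : 0 <= y * 2 by lra.
  rewrite ler_pdivrMr // -[leRHS](ger0_norm y2_ge0) -sqrtr_sqr.
  apply: ler_wsqrtr; rewrite exprMn; lra.
case: tau => x y [[[/= y_gt0 n xl xr]|[/= y_gt0 n xl xr]]|[/= xE //]].
- apply: (bound x) => //; last by rewrite ler_norml; lra.
  move: n; rewrite normc_def -[1]/(1%:C) ltcR /= => n; apply/ltW.
  by rewrite -[ltLHS]sqrtr1 ltr_sqrt // ltr_wpDl ?sqr_ge0 ?exprn_gt0 in n.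
- apply: (bound x) => //; last by rewrite ler_norml; lra.
  move: n; rewrite normc_def -[1]/(1%:C) => /complexI /= n.
  by rewrite -[leRHS]sqr_sqrtr ?n ?expr1n // addr_ge0 ?sqr_ge0.
Qed.

(** * Counting the points near tau *)

Theorem theorem3p1 (R : realType) (Delta : int) (D : int) (f : nat)
    (tau : R[i]) (eps : R)
    (Delta_lt0 : Delta < 0)
    (Delta_mod4 : (Delta = 0 %[mod 4])%Z \/ (Delta = 1 %[mod 4])%Z)
    (D_disc : quadratic_field_disc R Delta D)
    (f_gt0 : (0 < f)%N)
    (Delta_fD : Delta = f%:Z ^+ 2 * D)
    (tau_F : @fundamental_domain R tau)
    (eps_gt0 : 0 < eps) (eps_lt : eps < 2^-1) :
  let absDelta : R := `|Delta|%:~R in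
  let ft : nat := modified_conductor D f in
  finite_set (S_eps eps tau Delta) /\
  (C_eps eps tau Delta)%:R <=
    (F_max R Delta)%:R *
      ((48 + 16 * Num.sqrt 3) / 3 * ((sigma1 ft)%:R / ft%:R)
         * absDelta `^ 2^-1 * eps ^+ 2
       + (12 + 4 * Num.sqrt 3) / 3 * absDelta `^ 2^-1 * eps
       + 8 * absDelta `^ 4^-1 / (Num.sqrt 3 - 1) `^ 2^-1
         * (sigma0 ft)%:R * eps
       + 2).

Proof.
move=> absDelta ft.
have Delta0 : Delta != 0 by rewrite lt_eqF.
have ft_gt0 : (0 < ft)%N by rewrite /ft /modified_conductor; case: ifP => _; lia.
have [s DeltaE s_sqf] := modified_conductor_squarefree Delta_lt0 D_disc f_gt0 Delta_fD.
rewrite -/ft in DeltaE.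
have ft_max (d : nat) : (d%:Z ^+ 2 %| Delta)%Z -> (d %| ft)%N.
  by rewrite dvdzE abszX DeltaE; apply: sqr_dvdn_sqrM_squarefree.
have absDelta_ge0 : 0 <= absDelta by rewrite ler0z.
set N := absDelta `^ 2^-1.
have NE : N = Num.sqrt absDelta by rewrite /N powR12_sqrt.
have N_gt0 : 0 < N by rewrite NE sqrtr_gt0 ltr0z normr_gt0.
have v_ge := fundamental_domain_Im tau_F.
case: tau tau_F v_ge => x v tau_F /= v_ge; set r := Num.sqrt 3 in v_ge *.
have r2 : r ^+ 2 = 3 by rewrite sqr_sqrtr.
have r_ge0 : 0 <= r by apply: sqrtr_ge0.
have r_gt : 1 < r by rewrite /r -[ltLHS]sqrtr1 ltr_sqrt; lra.
(* The range of a = N / (2 Im z) when Im z lies within eps of v. *)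
pose hi := N / (2 * (v - eps)); pose lo := N / (2 * (v + eps)).
have vm : (r - 1) / 2 < v - eps by lra.
have vm_gt0 : 0 < v - eps by lra.
have vp_gt0 : 0 < v + eps by lra.
have hilo : hi - lo = N * eps / ((v - eps) * (v + eps)).
  by rewrite /hi /lo; field; rewrite !gt_eqF.
have hilo_le : hi - lo <= 2 * N * eps.
  rewrite hilo ler_pdivrMr ?mulr_gt0 //.
  (* v^2 >= 3/4 and eps^2 < 1/4. *)
  have : 2^-1 <= (v - eps) * (v + eps) by nra.
  have : 0 <= N * eps by rewrite mulr_ge0 ?ltW.
  by nra.
have lohi : lo <= hi by rewrite -subr_ge0 hilo divr_ge0 ?mulr_ge0 ?ltW.
have hi_le : hi <= N / (r - 1).
  rewrite /hi ler_pM2l // lef_pV2 ?posrE; lra.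
(* Since sqrt 3 - 1 > 1/2; this is the range of a that [exp_omega_le_F_max] covers. *)
have hi_le2 : hi <= 2 * N.
  apply: le_trans hi_le _; rewrite ler_pdivrMr; last by lra.
  by nra.
have sqrt_hi : Num.sqrt hi <= absDelta `^ 4^-1 / (r - 1) `^ 2^-1.
  have -> : absDelta `^ 4^-1 = Num.sqrt N.
    by rewrite -powR12_sqrt ?ltW // /N -powRrM; congr (_ `^ _); field.
  have r1_ge0 : 0 <= r - 1 by lra.
  rewrite (powR12_sqrt r1_ge0) -(sqrtrV r1_ge0) -(sqrtrM _ (ltW N_gt0)).
  exact: ler_wsqrtr.
set B := (X in _ <= X).
suff bound t : uniq t -> {in t, forall z, S_eps eps (x +i* v) Delta z} -> (size t)%:R <= B.
  exact: finite_set_uniq_seq_bound bound.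
(* Each z in t is replaced by its coefficients (a, b), which recover Re z and Im z; off t the value
   (0, 0) is a dummy. *)
move=> t_uniq t_S.
have ex_q (z : R[i]) : exists q : nat * int, z \in t ->
    [/\ (0 < q.1)%N, (4 * q.1%:Z %| q.2 ^+ 2 - Delta)%Z,
        2 * q.1%:R * complex.Re z = - q.2%:~R
      & 2 * q.1%:R * complex.Im z = N].
  have [/t_S [z_up z_quad _]|zt] := boolP (z \in t); last by exists (0%N, 0).
  have [a [b [? ? ? ?]]] := imaginary_quadratic_form z_up z_quad.
  by exists (a, b); rewrite NE.
have [q qP] := choice ex_q.
pose s' := map q t.
have s'_uniq : uniq s'.
  rewrite map_inj_in_uniq // => z1 z2 z1t z2t q12.
  have [a_gt0 _ re1 im1] := qP _ z1t; have [_ _ re2 im2] := qP _ z2t.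
  have a0 : 2 * (q z1).1%:R != 0 :> R by rewrite mulf_neq0 ?pnatr_eq0 -?lt0n.
  rewrite -q12 in re2 im2.
  apply/eqP; rewrite eq_complex; apply/andP; split; apply/eqP; apply: (mulfI a0).
    by rewrite re1 re2.
  by rewrite im1 im2.
have F0 : (0 : R) <= (2 * F_max R Delta)%:R by [].
have near z : z \in t -> [/\ - eps < complex.Re z - x, complex.Re z - x < eps,
    v - eps < complex.Im z & complex.Im z < v + eps].
  move=> /t_S [_ _ /normc_lt_Re_Im]; case: z => zx zy /=.
  by rewrite !ltr_norml => -[/andP [? ?] /andP [? ?]]; split; lra.
have : (size s')%:R <= (2 * F_max R Delta)%:R * (4 * eps * ((hi - lo) *
    ((sigma1 ft)%:R / ft%:R) + (sigma0 ft)%:R * Num.sqrt hi) + (hi - lo) + 1).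
  have s'_lohi : {in s', forall p, lo < p.1%:R < hi}.
    move=> _ /mapP [z zt ->]; have [a_gt0 _ _ imE] := qP _ zt.
    have [_ _ im1 im2] := near _ zt.
    have a0 : 0 < (q z).1%:R :> R by rewrite ltr0n.
    rewrite /lo /hi -imE ltr_pdivrMr ?ltr_pdivlMr ?mulr_gt0 //.
    by apply/andP; split; nra.
  (* b = - 2 a Re z with Re z within eps of x, so b / a lies in an interval of width 4 eps starting
     at - 2 x - 2 eps. *)
  apply: (@size_quadratic_forms _ Delta _ _ _ _ _ (- 2 * x - 2 * eps)) => //.
  - by rewrite mulr_ge0 ?ltW.
  - by move=> _ /mapP [z /qP [? ? _ _] ->].
  - move=> _ /mapP [z zt ->]; have [a_gt0 _ reE _] := qP _ zt.
    have [re1 re2 _ _] := near _ zt.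
    have a0 : 0 < (q z).1%:R :> R by rewrite ltr0n.
    rewrite -[(q z).2%:~R]opprK -reE; apply/andP; split; nra.
  - move=> p ps; have /andP [_ p_hi] := s'_lohi _ ps.
    rewrite ler_nat; apply: exp_omega_le_F_max => //.
      by move: ps => /mapP [z /qP [? _ _ _] ->].
    exact: le_trans (ltW p_hi) hi_le2.
rewrite size_map => /le_trans; apply.
rewrite /B [(2 * _)%N]mulnC natrM -[leLHS]mulrA; apply: ler_wpM2l => //.
set s1 := (sigma1 ft)%:R / _; set s0 := (sigma0 ft)%:R.
have s1_ge0 : 0 <= s1 by rewrite divr_ge0.
have s0_ge0 : 0 <= s0 by [].
set h4 := _ `^ 4^-1; set h2 := _ `^ 2^-1 in sqrt_hi *.
have e1 : eps * ((hi - lo) * s1) <= eps * (2 * N * eps * s1).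
  by rewrite ler_pM2l // ler_wpM2r.
have e2 : eps * (s0 * Num.sqrt hi) <= eps * (s0 * (h4 / h2)).
  by rewrite ler_pM2l // ler_wpM2l.
have e3 : 0 <= N * eps by rewrite mulr_ge0 ?ltW.
have e4 : 0 <= s1 * N * eps ^+ 2.
  by rewrite mulr_ge0 ?sqr_ge0 // mulr_ge0 //; apply: ltW.
have -> : 8 * h4 / h2 * s0 * eps = 8 * (eps * (s0 * (h4 / h2))) by ring.
(* 16 = 2 * 4 * 2: the 2 of 2 F, the width 4 eps, and hi - lo <= 2 N eps. The 4 of [r3] is the same
   product without the width. *)
have r1 : 16 * (s1 * N * eps ^+ 2) <= (48 + 16 * r) / 3 * s1 * N * eps ^+ 2.
  have c1 : 16 <= (48 + 16 * r) / 3 by lra.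
  by have := ler_wpM2r e4 c1; rewrite !mulrA.
have r3 : 4 * (N * eps) <= (12 + 4 * r) / 3 * N * eps.
  have c3 : 4 <= (12 + 4 * r) / 3 by lra.
  by have := ler_wpM2r e3 c3; rewrite !mulrA.
lra.
Qed.
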